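(* Suppose $Q_1,Q_2,Q_3$ are positive-definite integer-valued binary quadratic forms such that $$Q_1\sim_{\mathbb{Z}} c(x^2+xy+y^2),\qquad Q_2\sim_{\mathbb{Z}} 4c(x^2+xy+y^2),\qquad Q_3\sim_{\mathbb{Z}} c(x^2+3y^2)$$ for some positive integer $c\in\mathbb{Z}_{>0}$. Then $$\tfrac13\theta_{Q_1}+\tfrac23\theta_{Q_2}=\theta_{Q_3}.$$
   Context: For a positive-definite integer-valued binary quadratic form $Q$ and $m\in\mathbb{Z}_{\ge 0}$, $r_Q(m):=\#\{(x,y)\in\mathbb{Z}^2: Q(x,y)=m\}$, and the theta series is $\theta_Q(z):=\sum_{m\ge 0}r_Q(m)q^m$, $q=e^{2\pi i z}$. $Q\sim_{\mathbb{Z}}Q'$ means that the forms are related by a change of variables in $\mathrm{GL}_2(\mathbb{Z})$. *)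

(* Defs.v *)
From HB Require Import structures.
From mathcomp Require Import all_boot all_order all_algebra finmap.
From mathcomp Require Import all_classical all_reals all_analysis.
From mathcomp Require Import complex.

Set Implicit Arguments.
Unset Strict Implicit.
Unset Printing Implicit Defensive.

Import Order.TTheory GRing.Theory Num.Theory.
Import numFieldNormedType.Exports.

Local Open Scope classical_set_scope.
Local Open Scope ring_scope.
Local Open Scope complex_scope.

(* [BQF a b c] is a x^2 + b x y + c y^2. Integer-valued means valued in int on
   int^2, equivalently a, b, c are integers; b is not required to be even. *)
Record bqf := BQF { coefxx : int; coefxy : int; coefyy : int }.

Definition bqf_eval (Q : bqf) (x y : int) : int :=
  coefxx Q * x ^+ 2 + coefxy Q * x * y + coefyy Q * y ^+ 2.

(* As the coefficients are integers, positivity on nonzero integer vectors is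
   the same as positivity on nonzero real vectors. *)
Definition posdef (Q : bqf) : Prop :=
  forall x y : int, (x, y) != (0, 0) -> 0 < bqf_eval Q x y.

Definition equivZ (Q Q' : bqf) : Prop :=
  exists2 g : 'M[int]_2, g \in unitmx &
    forall x y : int,
      bqf_eval Q x y =
      bqf_eval Q' (g ord0 ord0 * x + g ord0 ord_max * y)
                  (g ord_max ord0 * x + g ord_max ord_max * y).

(* [fset_set] is the empty set on an infinite set; the set below is finite
   whenever Q is positive-definite. *)
Definition repr_num (Q : bqf) (m : nat) : nat :=
  #|` fset_set [set v : int * int | bqf_eval Q v.1 v.2 = m%:Z] |.

Definition expC (R : realType) (z : R[i]) : R[i] :=
  (expR (complex.Re z))%:C * (cos (complex.Im z) +i* sin (complex.Im z)).

Definition nome (R : realType) (z : R[i]) : R[i] :=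
  expC ((0 +i* (2 * pi)) * z).

(* The infinite sum is the limit of the partial sums in R[i], for the topology
   of the modulus; it is meant for z in the upper half-plane. *)
Definition theta (R : realType) (Q : bqf) (z : R[i]) : R[i] :=
  limn (series (fun m => (repr_num Q m)%:R * nome z ^+ m) : nat -> R[i]^o).

(* Main.v *)
(* Let H be the set of solutions of c(x^2 + xy + y^2) = m. The solutions with
   both coordinates even correspond to the representations of m by
   4c(x^2 + xy + y^2), and (x, y) |-> (x - y, 2y) maps the representations of m
   by c(x^2 + 3y^2) onto the solutions with y even. Every (x, y) has either
   exactly one or all three of x, y, x + y even, and the automorphism
   (x, y) |-> (-y, x + y) of the form permutes these three conditions, so
   r_{Q1}(m) + 2 r_{Q2}(m) = 3 r_{Q3}(m). The power series identity follows
   since r_Q(m) grows at most quadratically, so that the theta series converge. *)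
Require Import Defs.
From HB Require Import structures.
From mathcomp Require Import all_boot all_order all_algebra finmap.
From mathcomp Require Import all_classical all_reals all_analysis.
From mathcomp Require Import complex.
From mathcomp Require Import zify ring lra.

Import Order.TTheory GRing.Theory Num.Theory.
Import numFieldNormedType.Exports.

Local Open Scope ring_scope.
Local Open Scope complex_scope.

(** * Representation numbers under change of variables *)

Lemma card_fset_set_inj {T U : choiceType} {f : T -> U} (A : set T)
    (B : set U) :
  injective f -> (f @` A)%classic = B -> #|` fset_set A| = #|` fset_set B|.
Proof.
move=> f_inj <-; have AB := inj_card_eq (A := A) (in2W f_inj).
have [Afin|Ainf] := pselect (finite_set A).
  by apply/fcard_eq => //; [rewrite (eq_finite_set AB)|rewrite card_eq_sym].
(* On infinite sets fset_set is empty, so both sides are 0. *)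
rewrite /fset_set; case: pselect => // _; case: pselect => // Bfin.
by case: Ainf; rewrite -(eq_finite_set AB).
Qed.

(** The matrix [g] acts bijectively on integer vectors, with inverse [invmx g], and carries the
    representations by [Q] onto those by [Q']. *)
Lemma repr_num_equivZ (Q Q' : bqf) (m : nat) :
  equivZ Q Q' -> repr_num Q m = repr_num Q' m.
Proof.
case=> g g_unit QQ'.
pose act (h : 'M[int]_2) (v : int * int) :=
  (h ord0 ord0 * v.1 + h ord0 ord_max * v.2,
   h ord_max ord0 * v.1 + h ord_max ord_max * v.2).
have actM h k v : act h (act k v) = act (h *m k) v.
  rewrite /act !mxE !big_ord_recl !big_ord0 /=.
  have -> : lift ord0 ord0 = ord_max :> 'I_2 by exact/val_inj.
  congr pair; rewrite !addr0.
    by ring.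
  by ring.
have act1 v : act 1%:M v = v.
  by case: v => x y; rewrite /act !mxE /=; congr pair; ring.
have gK : cancel (act g) (act (invmx g)) by move=> v; rewrite actM mulVmx.
have gVK : cancel (act (invmx g)) (act g) by move=> v; rewrite actM mulmxV.
apply: (card_fset_set_inj _ _ (can_inj gK)).
apply/seteqP; split=> [_ [v Qv <-]|v Qv].
  by rewrite /= -QQ'.
exists (act (invmx g) v); last exact: gVK.
rewrite /= QQ'.
exact: etrans (congr1 (fun w => bqf_eval Q' w.1 w.2) (gVK v)) Qv.
Qed.

(** * Counting on the hexagonal lattice *)

Section hexagonal.
Context (c : int) (m : nat) (c_gt0 : 0 < c).

Let H : set (int * int) :=
  [set v | bqf_eval (BQF c c c) v.1 v.2 = m%:Z]%classic.

(** The square [-2m, 2m]^2, as a shifted image of pairs of ordinals so that its size is at most (4m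
    + 1)^2. *)
Let box : {fset int * int} :=
  [fset ((val ij.1)%:Z - (2 * m)%:Z, (val ij.2)%:Z - (2 * m)%:Z)
    | ij in {: 'I_(4 * m + 1) * 'I_(4 * m + 1)}]%fset.

Let H_box : (H `<=` [set` box])%classic.
Proof.
have abs_le (x y : int) :
    x ^+ 2 + x * y + y ^+ 2 <= m%:Z -> `|x| <= (2 * m)%:Z.
  move=> h.
  (* 4(x^2 + xy + y^2) = 3x^2 + (x + 2y)^2. *)
  have h3 : 3 * x ^+ 2 <= 4 * m%:Z by have := sqr_ge0 (x + 2 * y); lia.
  have : `|x| <= x ^+ 2 by nia.
  lia.
move=> [x y]; rewrite /H /= /bqf_eval /= => xy_m.
have h : x ^+ 2 + x * y + y ^+ 2 <= m%:Z.
  (* Once q >= 0 is known, c >= 1 gives q <= cq = m. *)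
  have : 0 <= x ^+ 2 + x * y + y ^+ 2.
    have := sqr_ge0 (x + y); have := sqr_ge0 x; have := sqr_ge0 y; lia.
  set q := (X in 0 <= X).
  have <- : c * q = m%:Z by rewrite -xy_m /q; ring.
  move=> q0; rewrite ler_peMl //; lia.
have xm := abs_le _ _ h.
have ym : `|y| <= (2 * m)%:Z by apply: (abs_le y x); lra.
have xi : (absz (x + (2 * m)%:Z)%R < 4 * m + 1)%N by lia.
have yi : (absz (y + (2 * m)%:Z)%R < 4 * m + 1)%N by lia.
apply/imfsetP; exists (Ordinal xi, Ordinal yi) => //=.
by congr pair; lia.
Qed.

Let H_finite : finite_set H.
Proof. by apply: sub_finite_set H_box _; exact: finite_fset. Qed.

Lemma repr_num_hexagonal_le : (repr_num (BQF c c c) m <= 16 * m.+1 ^ 2)%N.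
Proof.
have : (repr_num (BQF c c c) m <= #|` box|)%N.
  rewrite -[box]set_fsetK; apply: fsubset_leq_card.
  by rewrite -fset_set_sub.
move=> /leq_trans; apply; apply: (leq_trans (leq_imfset_card _ _ _)).
rewrite -cardE card_prod !card_ord; nia.
Qed.

Let part (P : pred (int * int)) : nat := #|` fset_set (H `&` [set` P])%classic|.

(** Linear relations between parts thereby reduce to pointwise relations between indicators. *)
Let partE P : part P = (\sum_(v <- fset_set H) P v)%N.
Proof.
rewrite /part.
have -> : fset_set (H `&` [set` P])%classic =
    [fset v in fset_set H | P v]%fset.
  apply/fsetP => v; rewrite in_fset_set; last exact: finite_setIl.
  rewrite !inE /= in_fset_set //.
  by apply/idP/andP => [/set_mem[Hv Pv]|[/set_mem Hv Pv]];
    [split=> //|]; exact/mem_set.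
rewrite card_fset_sum1 big_fset big_mkcond.
by apply: eq_bigr => v _; case: (P v).
Qed.

(** Multiplication by w = e^(i pi/3) on x + yw, whose norm is x^2 + xy + y^2; a rotation by 60
    degrees. *)
Let rot (v : int * int) : int * int := (- v.2, v.1 + v.2).

Let part_rot (P P' : pred (int * int)) :
  (forall v, P' (rot v) = P v) -> part P = part P'.
Proof.
move=> PP'; apply: (card_fset_set_inj (f := rot)).
  by move=> [x y] [x' y'] [e1 e2]; congr pair; lia.
apply/seteqP; split=> [_ [[x y] [Hv Pv] <-]|[x y] [Hv Pv]].
  split; last exact: etrans (PP' _) Pv.
  by apply: etrans Hv; rewrite /bqf_eval /=; ring.
(* The inverse rotation supplies the preimage. *)
have rotE : rot (x + y, - x) = (x, y) by rewrite /rot /=; congr pair; lia.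
exists (x + y, - x) => //; split.
  by apply: etrans Hv; rewrite /bqf_eval /=; ring.
by apply: etrans (esym (PP' _)) _; rewrite rotE.
Qed.

Lemma repr_num_4hexagonal :
  repr_num (BQF (4 * c) (4 * c) (4 * c)) m =
  part [pred v | (2 %| v.1)%Z && (2 %| v.2)%Z].
Proof.
apply: (card_fset_set_inj (f := fun v => (2 * v.1, 2 * v.2))).
  by move=> [x y] [x' y'] [e1 e2]; congr pair; lia.
apply/seteqP; split=> [_ [[x y] Hv <-]|].
  split; first by apply: etrans Hv; rewrite /bqf_eval /=; ring.
  by apply/andP; split; exact: dvdz_mulr.
move=> [x y] [Hv /andP[/dvdzP[x' /= xE] /dvdzP[y' /= yE]]].
exists (x', y'); last by rewrite /= xE yE ![_ * 2]mulrC.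
by apply: etrans Hv; rewrite /bqf_eval /= xE yE; ring.
Qed.

(** With w = e^(i pi/3), sqrt(-3) = 2w - 1, so x + y sqrt(-3) = (x - y) + 2yw. *)
Lemma repr_num_rectangular :
  repr_num (BQF c 0 (3 * c)) m = part [pred v | (2 %| v.2)%Z].
Proof.
apply: (card_fset_set_inj (f := fun v => (v.1 - v.2, 2 * v.2))).
  by move=> [x y] [x' y'] [e1 e2]; congr pair; lia.
apply/seteqP; split=> [_ [[x y] Hv <-]|[x y] [Hv /dvdzP[y' /= yE]]].
  split; first by apply: etrans Hv; rewrite /bqf_eval /=; ring.
  exact: dvdz_mulr.
exists (x + y', y'); last by rewrite /= addrK yE [_ * 2]mulrC.
by apply: etrans Hv; rewrite /bqf_eval /= yE; ring.
Qed.

Lemma repr_num_hexagonal_rectangular :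
  (repr_num (BQF c c c) m + 2 * repr_num (BQF (4 * c) (4 * c) (4 * c)) m =
   3 * repr_num (BQF c 0 (3 * c)) m)%N.
Proof.
pose even1 : pred (int * int) := [pred v | (2 %| v.1)%Z].
pose even2 : pred (int * int) := [pred v | (2 %| v.2)%Z].
pose even12 : pred (int * int) := [pred v | (2 %| v.1 + v.2)%Z].
have e21 : part even2 = part even1 by apply: part_rot => v; exact: rpredN.
have e12_2 : part even12 = part even2 by exact: part_rot.
rewrite repr_num_4hexagonal repr_num_rectangular -[part _ in RHS]/(part even2).
have -> : (3 * part even2 = part even1 + part even2 + part even12)%N by lia.
have -> : repr_num (BQF c c c) m = part predT.
  rewrite /part [X in fset_set X](_ : _ = H) //.
  by apply/seteqP; split=> v // [].
rewrite !partE big_distrr -!big_split /=.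
(* Pointwise, 1 + 2[x, y even] = [x even] + [y even] + [x + y even]: both sides are 3 if x and y are
   even, and 1 otherwise. *)
by apply: eq_bigr => -[x y] _; rewrite /even1 /even2 /even12 /=; lia.
Qed.

Lemma repr_num_4hexagonal_le :
  (repr_num (BQF (4 * c) (4 * c) (4 * c)) m <= repr_num (BQF c c c) m)%N.
Proof.
rewrite repr_num_4hexagonal; apply: fsubset_leq_card.
rewrite -fset_set_sub; [exact: subIsetl | exact: finite_setIl |].
exact: H_finite.
Qed.

End hexagonal.

(** * Convergence of theta series in the upper half-plane *)

Section complex_series.
Local Open Scope classical_set_scope.
Context {R : realType}.

Lemma normc_le_ReIm (w : R[i]) :
  Normc.normc w <= `|complex.Re w| + `|complex.Im w|.
Proof.
case: w => x y /=; rewrite -[leRHS]ger0_norm ?addr_ge0//.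
rewrite -sqrtr_sqr ler_wsqrtr // sqrrD !real_normK ?num_real// -subr_ge0.
rewrite [X in 0 <= X](_ : _ = (`|x| * `|y|) *+ 2); last by ring.
by rewrite mulrn_wge0 ?mulr_ge0.
Qed.

Lemma cvg_complex (u : nat -> R[i]^o) (a b : R) :
  (fun n => complex.Re (u n)) @ \oo --> a ->
  (fun n => complex.Im (u n)) @ \oo --> b -> u @ \oo --> (a +i* b : R[i]^o).
Proof.
(* The norm of [R[i]] takes values in [R[i]], so the radius is complex; being positive, it has
   imaginary part 0. *)
move=> ua ub; apply/cvgrPdist_lt => -[e e'] /[!ltcE]/= /andP[/eqP -> e_gt0].
have e2_gt0 : 0 < e / 2 by rewrite divr_gt0.
move/cvgrPdist_lt : ua => /(_ _ e2_gt0) ua.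
move/cvgrPdist_lt : ub => /(_ _ e2_gt0) ub.
near=> n.
rewrite -[ltRHS]/(e%:C) -[X in X < _]/((Normc.normc _)%:C) ltcR.
rewrite (le_lt_trans (normc_le_ReIm _)) //.
rewrite [e]splitr !raddfB /=.
by apply: ltrD; near: n.
Unshelve. all: end_near. Qed.

Lemma Re_le_normc (w : R[i]) : `|complex.Re w| <= Normc.normc w.
Proof. by rewrite -lecR; exact: normc_ge_Re. Qed.

Lemma Im_le_normc (w : R[i]) : `|complex.Im w| <= Normc.normc w.
Proof. by case: w => x y; rewrite -sqrtr_sqr ler_wsqrtr // lerDr sqr_ge0. Qed.

(** Comparison test: the real and imaginary parts are dominated by [v], so both of their series
    converge absolutely. *)
Lemma cvg_series_complex (u : nat -> R[i]^o) (v : nat -> R) :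
  (forall n, Normc.normc (u n) <= v n) -> cvgn (series v) -> cvgn (series u).
Proof.
move=> uv v_cvg.
have part_cvg (f : {additive R[i] -> R}) :
    (forall w, `|f w| <= Normc.normc w) -> cvgn (fun n => f (series u n)).
  move=> f_le.
  rewrite (_ : (fun n => f _) = series (fun n => f (u n))); last first.
    by apply/funext => n; rewrite /series /= raddf_sum.
  apply: normed_cvg; apply: series_le_cvg v_cvg => n //=.
    by apply: le_trans (uv n); case: (u n) => x y; exact: sqrtr_ge0.
  exact: le_trans (f_le _) (uv n).
have /cvg_ex[/= a Re_cvg] := part_cvg (@complex.Re R) Re_le_normc.
have /cvg_ex[/= b Im_cvg] := part_cvg (@complex.Im R) Im_le_normc.
by apply/cvg_ex; exists (a +i* b); exact: cvg_complex.
Qed.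

Lemma normc_nome (z : R[i]) :
  Normc.normc (nome z) = expR (- (2 * pi * complex.Im z)).
Proof.
case: z => x y; rewrite /nome /expC /=.
rewrite [0 * x]mul0r sub0r !mul0r !subr0 !addr0 !exprMn -mulrDr cos2Dsin2 mulr1.
by rewrite sqrtr_sqr ger0_norm ?expR_ge0.
Qed.

(** Since |q| = e^(-a) with a > 0, the terms are dominated by a geometric series of ratio
    e^(-a/2). *)
Lemma cvg_theta_series (Q : bqf) (K : nat) (z : R[i]) :
  (forall m, (repr_num Q m <= K * m.+1 ^ 2)%N) -> 0 < complex.Im z ->
  cvgn (series (fun m => (repr_num Q m)%:R * nome z ^+ m) : nat -> R[i]^o).
Proof.
move=> Q_le z_gt0.
set a := 2 * pi * complex.Im z.
have a_gt0 : 0 < a by rewrite !mulr_gt0 // pi_gt0.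
(* With u = am/4, e^u >= 1 + u bounds 1 by e^u and m by (4/a)e^u, hence m + 1 <= C e^u. *)
pose C := 1 + 4 / a.
have C_gt0 : 0 < C by rewrite addr_gt0 ?divr_gt0.
pose t := expR (- (a / 2)).
have t_lt1 : `|t| < 1.
  by rewrite ger0_norm ?expR_ge0 // expR_lt1 oppr_lt0 divr_gt0.
apply: cvg_series_complex
  (is_cvg_geometric_series (a := K%:R * C ^+ 2) t_lt1) => m.
have -> : Normc.normc ((repr_num Q m)%:R * nome z ^+ m) =
    (repr_num Q m)%:R * expR (- a) ^+ m.
  (* Embedding the equation in [R[i]] turns [Normc.normc] into the multiplicative norm there. *)
  apply: complexI; rewrite rmorphM rmorphXn rmorph_nat -normc_nome.
  transitivity `|(repr_num Q m)%:R * nome z ^+ m|; first by [].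
  by rewrite normrM normrX normr_nat.
(* Squared, this absorbs the factor (m + 1)^2 into half of the decay e^(-am). *)
have succ_le : m.+1%:R <= C * expR (a * m%:R / 4).
  have := expR_ge1Dx (a * m%:R / 4).
  set X := expR _ => X_ge.
  rewrite -natr1 addrC /C mulrDl mul1r lerD //.
    have aX : 0 <= a * m%:R / 4.
      by apply: divr_ge0 => //; apply: mulr_ge0 => //; exact: ltW.
    by apply: le_trans X_ge; rewrite lerDl.
  by rewrite mulrAC ler_pdivlMr // [leLHS]mulrC; lra.
have tE : t ^+ m = expR (a * m%:R / 4) ^+ 2 * expR (- a) ^+ m.
  by rewrite /t -!expRM_natl -expRD; congr expR; field.
rewrite /= tE mulrA -[_ * C ^+ 2 * _]mulrA -exprMn.
rewrite ler_pM2r ?exprn_gt0 ?expR_gt0 //.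
apply: le_trans (_ : (K * m.+1 ^ 2)%:R <= _); first by rewrite ler_nat.
rewrite natrM ler_wpM2l // natrX; apply: lerXn2r => //.
  by rewrite nnegrE.
by rewrite nnegrE (le_trans _ succ_le).
Qed.

End complex_series.

(** * From coefficients to theta series *)

Theorem lemma6p2 (R : realType) (Q1 Q2 Q3 : bqf) (c : int)
    (pos1 : posdef Q1) (pos2 : posdef Q2) (pos3 : posdef Q3)
    (c_gt0 : 0 < c)
    (equiv1 : equivZ Q1 (BQF c c c))
    (equiv2 : equivZ Q2 (BQF (4 * c) (4 * c) (4 * c)))
    (equiv3 : equivZ Q3 (BQF c 0 (3 * c))) :
  forall z : R[i], 0 < complex.Im z ->
    1 / 3 * theta Q1 z + 2 / 3 * theta Q2 z = theta Q3 z.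
Proof.
move=> z z_gt0.
have Q123 m : (repr_num Q1 m + 2 * repr_num Q2 m = 3 * repr_num Q3 m)%N.
  rewrite (repr_num_equivZ _ _ _ equiv1) (repr_num_equivZ _ _ _ equiv2).
  rewrite (repr_num_equivZ _ _ _ equiv3).
  exact: repr_num_hexagonal_rectangular.
have Q1_le m : (repr_num Q1 m <= 16 * m.+1 ^ 2)%N.
  by rewrite (repr_num_equivZ _ _ _ equiv1); exact: repr_num_hexagonal_le.
have Q2_le m : (repr_num Q2 m <= 16 * m.+1 ^ 2)%N.
  apply: leq_trans (Q1_le m).
  rewrite (repr_num_equivZ _ _ _ equiv1) (repr_num_equivZ _ _ _ equiv2).
  exact: repr_num_4hexagonal_le.
have cvg1 := cvg_theta_series _ _ _ Q1_le z_gt0.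
have cvg2 := cvg_theta_series _ _ _ Q2_le z_gt0.
(* The partial sums for [Q3] equal the combination of those for [Q1] and [Q2], so their convergence
   follows from the other two. *)
apply/esym; apply: (@cvg_lim (R[i]^o)); first exact: norm_hausdorff.
pose S Q := series (fun m => (repr_num Q m)%:R * nome z ^+ m : R[i]^o).
rewrite (_ : series _ = fun n => 1 / 3 * S Q1 n + 2 / 3 * S Q2 n).
  apply: cvgD; apply: cvgMl_tmp; [exact: cvg1|exact: cvg2].
apply/funext => n; rewrite /S /series /= !mulr_sumr -big_split /=.
apply: eq_bigr => m _.
have := congr1 (fun k => k%:R : R[i]) (Q123 m).
rewrite natrD !natrM => Q123R.
have -> : (repr_num Q3 m)%:R =
    1 / 3 * ((repr_num Q1 m)%:R + 2 * (repr_num Q2 m)%:R) :> R[i].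
  by rewrite Q123R; field.
by field.
Qed.
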